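(* Let $\ell\ge 5$ be a prime number, $N>0$ an integer prime to $\ell$, and $k>2$ an integer. Let $f\in S_{k}(\Gamma_{0}(N))$ be a normalized eigenform and let $\lambda$ be a prime of $K_f$ lying over $\ell$. Suppose the representation $\rho_{f,\lambda}$ is irreducible. Let $i$ be an integer with $0\le i \le \ell-1$ such that, with $$H=\{x \bmod N\ell \ :\ 0<x<N\ell,\ \gcd(x,N\ell)=1,\ \varepsilon(x)\,x^{k-2-2i} \equiv 1 \bmod \lambda \}\subseteq (\mathbb{Z}/N\ell\mathbb{Z})^{*},\qquad \Gamma_H=\Gamma_H(N\ell)$$ (where $\varepsilon$ is the nebentypus character of $f$, here trivial), there exist a normalized eigenform $f_2\in S_2(\Gamma_H)$ and a prime $\lambda_2$ of $K_{f_2}$ over $\ell$ with $\rho_{f,\lambda}\cong\rho_{f_2,\lambda_2}\otimes\chi_\ell^i$. Then the index of $\Gamma_{1}(N\ell)$ in $\Gamma_H$ is $$[\Gamma_{H}:\Gamma_1(N\ell)]=\frac{\phi(N\ell)\cdot \gcd(\ell-1,\,k-2-2i)}{\ell-1}.$$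
   Context: $\phi$ is Euler's totient function. For a positive integer $n$ and a subgroup $H$ of $(\mathbb{Z}/n\mathbb{Z})^{*}$, $\Gamma_H(n)$ is the group of matrices $\begin{pmatrix} a&b\\c&d\end{pmatrix}\in SL(2,\mathbb{Z})$ with $c\equiv 0 \pmod n$ and $d \bmod n\in H$; $\Gamma_0(n)$ and $\Gamma_1(n)$ are the cases $H=(\mathbb{Z}/n\mathbb{Z})^*$ and $H=\{1\}$. $S_k(\Gamma)$ is the space of cusp forms of weight $k$ on $\Gamma$. A normalized eigenform $g=\sum_{m>0}a_m(g)q^m$ is a Hecke eigenform with $a_1(g)=1$; $K_g$ is the number field generated by all the coefficients $a_m(g)$. For a normalized eigenform $g\in S_k(\Gamma_1(n))$ with nebentypus $\varepsilon$ and a prime $\mu$ of $K_g$ over $\ell$, with residue field embedded in $\overline{\mathbb{F}}_\ell$, $\rho_{g,\mu}:\mathrm{Gal}(\overline{\mathbb{Q}}/\mathbb{Q})\to GL_2(\overline{\mathbb{F}}_\ell)$ is the unique (up to isomorphism) continuous semisimple representation, unramified outside $n\ell$, such that for all primes $p\nmid n\ell$ the characteristic polynomial of $\rho_{g,\mu}(\mathrm{Frob}_p)$ is $x^2-a_p(g)x+\varepsilon(p)p^{k-1} \bmod \mu$; isomorphisms between representations attached to different forms are understood for suitable embeddings of residue fields. $\chi_\ell$ is the mod $\ell$ cyclotomic character. Negative powers of $x$ are taken modulo $\ell$. *)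

(* Defs.v *)
From HB Require Import structures.
From mathcomp Require Import all_boot all_order all_algebra all_field.
From mathcomp Require Import finmap complex.
From mathcomp Require Import all_classical all_reals all_analysis.

Set Implicit Arguments.
Unset Strict Implicit.
Unset Printing Implicit Defensive.

Import Order.TTheory GRing.Theory Num.Theory.
Import numFieldNormedType.Exports.

Local Open Scope classical_set_scope.
Local Open Scope ring_scope.

Definition SL2Z : set 'M[int]_2 := [set g : 'M[int]_2 | \det g = 1].

(* Z/nZ is represented by the least residues 'I_n rather than by 'Z_n, so that
   the level n = 1 is covered: there (Z/nZ)^* = {0}. *)
Definition Zn_units (n : nat) : {set 'I_n} := [set x : 'I_n | coprime x n]%SET.
Definition Zn_one (n : nat) : {set 'I_n} := [set x : 'I_n | x == 1 %[mod n]]%SET.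

Definition GammaH (n : nat) (H : {set 'I_n}) : set 'M[int]_2 :=
  [set g : 'M[int]_2 | [/\ \det g = 1, (n %| g 1%R 0%R)%Z
             & exists2 x : 'I_n, x \in H & (g 1%R 1%R = x %[mod n])%Z]].

Definition Gamma0 (n : nat) := GammaH (Zn_units n).
Definition Gamma1 (n : nat) := GammaH (Zn_one n).

Definition left_cosets (G D : set 'M[int]_2) : set (set 'M[int]_2) :=
  [set [set g *m d | d in D] | g in G].

(* [G : D], with the convention that an infinite index is 0. *)
Definition group_index (G D : set 'M[int]_2) : nat :=
  #|` fset_set (left_cosets G D)|%fset.

Section Primes.
Variables (T : comPzRingType) (F : pzRingType).

(* P is a prime ideal of the subring O of T, and it lies over the prime l. *)
Definition prime_over (O P : set T) (l : nat) : Prop :=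
  [/\ P `<=` O /\ P 0,
      forall x y, P x -> P y -> P (x + y),
      forall x y, O x -> P y -> P (x * y),
      ~ P 1 /\ (forall x y, O x -> O y -> P (x * y) -> P x \/ P y)
    & P l%:R].

(* iota restricts to a ring morphism O -> F with kernel P, i.e. it induces an
   embedding of O / P in F; its values outside O are irrelevant. *)
Definition residue_embedding (O P : set T) (iota : T -> F) : Prop :=
  [/\ iota 1 = 1,
      forall x y, O x -> O y -> iota (x + y) = iota x + iota y,
      forall x y, O x -> O y -> iota (x * y) = iota x * iota y
    & forall x, O x -> (iota x = 0 <-> P x)].

End Primes.

Section ModularForms.
Variable R : realType.
Local Notation C := R[i].

Definition upper_half_plane : set C := [set z | 0 < complex.Im z].

(* exp (2 i pi z) *)
Definition cexp2pi (z : C) : C :=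
  let t := 2 * pi * complex.Re z in
  (expR (- (2 * pi * complex.Im z)))%:C%C * (cos t +i* sin t)%C.

Definition slash (k : nat) (g : 'M[int]_2) (f : C -> C) (z : C) : C :=
  let j := (g 1 0)%:~R * z + (g 1 1)%:~R in
  j ^- k * f (((g 0 0)%:~R * z + (g 0 1)%:~R) / j).

(* f z = sum_m b_m q^m on the upper half plane, with q = exp (2 i pi z / h). *)
Definition fourier_expansion (h : nat) (f : C -> C) (b : nat -> C) : Prop :=
  forall z, upper_half_plane z ->
    series (fun m => b m * cexp2pi (m%:R * z / h%:R) : C^o) @ \oo --> (f z : C^o).

(* Modular forms are functions on the upper half plane; the values of
   f : C -> C elsewhere play no role. *)
Definition cusp_form (k : nat) (G : set 'M[int]_2) (f : C -> C) : Prop :=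
  [/\ forall z, upper_half_plane z -> derivable (f : C^o -> C^o) z 1,
      forall g, G g -> {in upper_half_plane, slash k g f =1 f}
    & forall g, SL2Z g -> exists h b,
        [/\ (0 < h)%N, b 0%N = 0 & fourier_expansion h (slash k g f) b]].

Definition dirichlet_character (n : nat) (eps : int -> C) : Prop :=
  [/\ forall x y, eps (x * y) = eps x * eps y,
      forall x y, (x = y %[mod n])%Z -> eps x = eps y
    & forall x, (eps x != 0) = coprimez x n].

Definition has_nebentypus (n k : nat) (eps : int -> C) (f : C -> C) : Prop :=
  dirichlet_character n eps /\
  forall g, Gamma0 n g -> {in upper_half_plane, slash k g f =1 eps (g 1 1) \*o f}.

(* The Hecke operator T_p (U_p if p divides the level, as then eps p = 0) on
   forms of weight k and nebentypus eps. *)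
Definition hecke (k : nat) (eps : int -> C) (p : nat) (f : C -> C) (z : C) : C :=
  p%:R^-1 * (\sum_(j < p) f ((z + j%:R) / p%:R))
    + eps p * p%:R ^+ k.-1 * f (p%:R * z).

(* f is a Hecke eigenform in S_k(Gamma_H(n)) with nebentypus eps and
   q-expansion sum_(m > 0) a_m q^m, where a_1 = 1.  Having a nebentypus means
   being an eigenvector of the diamond operators; together with the T_p, p
   prime, these generate the Hecke algebra. *)
Definition normalized_eigenform (k n : nat) (H : {set 'I_n}) (eps : int -> C)
    (f : C -> C) (a : nat -> C) : Prop :=
  [/\ cusp_form k (GammaH H) f,
      has_nebentypus n k eps f,
      exists2 z, upper_half_plane z & f z != 0,
      forall p, prime p -> exists c, {in upper_half_plane, hecke k eps p f =1 c \*o f}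
    & [/\ fourier_expansion 1 f a, a 0%N = 0 & a 1%N = 1]].

(* K_g: the subfield of C generated by the coefficients. *)
Definition coef_field (a : nat -> C) : set C :=
  [set x | forall S : {pred C}, divring_closed S -> (forall m, a m \in S) -> x \in S].

Definition coef_integers (a : nat -> C) : set C :=
  [set x | coef_field a x /\ integralOver (intr : int -> C) x].

(* The set of x in (Z/nZ)^* with eps(x) x^e = 1 mod lam, for lam over l and l
   dividing n; e may be negative, and x^e is computed modulo l and lifted to
   a least residue. *)
Definition char_kernel (n l : nat) (lam : set C) (eps : int -> C) (e : int)
    : {set 'I_n} :=
  [set x : 'I_n | [&& (0 < x)%N, coprime x n
    & eps x * (val ((x%:R : 'F_l) ^ e))%:R - 1 \in lam]]%SET.

End ModularForms.

Section Galois.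

(* algC is an algebraic closure of Q, and its ring endomorphisms are
   automorphisms. *)
Definition galQ : Type := {rmorphism algC -> algC}.

Definition Zbar : set algC := [set x | x \in Aint].

Definition is_Frobenius (p : nat) (s : galQ) : Prop :=
  exists2 P : set algC, prime_over Zbar P p
    & forall x, Zbar x -> P (s x - x ^+ p).

Definition in_inertia (p : nat) (s : galQ) : Prop :=
  exists2 P : set algC, prime_over Zbar P p & forall x, Zbar x -> P (s x - x).

Variable F : fieldType.

Definition algebraic_over_Fp (l : nat) : Prop :=
  l \in [pchar F] /\
  forall x : F, exists2 q : {poly 'F_l}, q != 0
    & root (map_poly (fun c : 'F_l => (val c)%:R) q) x.

(* Continuity is with respect to the Krull topology and the discrete topology
   on GL_2(F).  Invertibility of the values follows from the first two laws. *)
Record galrep : Type := Galrep {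
  galrep_fun :> galQ -> 'M[F]_2;
  galrep1 : galrep_fun (idfun : {rmorphism algC -> algC}) = 1%:M;
  galrepM : forall s t : galQ,
    galrep_fun (s \o t : {rmorphism algC -> algC}) = galrep_fun s *m galrep_fun t;
  galrep_cont : forall s : galQ, exists xs : seq algC, forall t : galQ,
    {in xs, t =1 s} -> galrep_fun t = galrep_fun s }.

(* Subspaces of the space of column vectors are row spaces of matrices U, hence
   the transpose. *)
Definition galrep_stable (rho : galrep) (U : 'M[F]_2) : Prop :=
  forall s, stablemx U (rho s)^T.

Definition galrep_irreducible (rho : galrep) : Prop :=
  forall U, galrep_stable rho U -> U = 0 \/ row_full U.

Definition galrep_semisimple (rho : galrep) : Prop :=
  forall U, galrep_stable rho U -> exists W,
    [/\ galrep_stable rho W, (U :&: W = 0)%MS & row_full (U + W)%MS].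

Definition galrep_iso (rho1 rho2 : galQ -> 'M[F]_2) : Prop :=
  exists2 P : 'M[F]_2, P \in unitmx & forall s, rho1 s *m P = P *m rho2 s.

Definition unramified_at (rho : galrep) (p : nat) : Prop :=
  forall s, in_inertia p s -> rho s = 1%:M.

(* The exponent m is only determined modulo l, so this is meant for F of
   characteristic l. *)
Definition cyclotomic_char (l : nat) (s : galQ) : F :=
  (xget 0%N [set m : nat | forall z : algC, z ^+ l = 1 -> s z = z ^+ m])%:R.

(* rho is rho_{g,mu} for g of level n, weight k and nebentypus eps, with
   coefficients a, where the residue field of mu is embedded in F via iota. *)
Definition attached_rep (R : realType) (l k n : nat) (eps : int -> R[i])
    (a : nat -> R[i]) (iota : R[i] -> F) (rho : galrep) : Prop :=
  galrep_semisimple rho /\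
  forall p, prime p -> ~~ (p %| n * l)%N ->
    unramified_at rho p /\
    forall s, is_Frobenius p s ->
      char_poly (rho s) =
        'X^2 - (iota (a p))%:P * 'X + (iota (eps p * p%:R ^+ k.-1))%:P.

End Galois.

(* Main.v *)
(** For [g] in [Gamma0 N] with lower right entry [d], [f] slashed by [g] is both
    [f] and [eps d * f]; as [f] is nonzero, [eps d = 1].  Hence [H] is the set of
    units [x] modulo [N * l] with [x ^ (k - 2 - 2 i) = 1] in the cyclic group
    ['F_l^*], and the Chinese remainder theorem gives
    [#|H| = phi(N) gcd(l - 1, k - 2 - 2 i)].  The lower right entry modulo
    [N * l] identifies [GammaH H / Gamma1 (N * l)] with [H]. *)

Require Import Defs.
From HB Require Import structures.
From mathcomp Require Import all_boot all_order all_algebra all_field.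
From mathcomp Require Import finmap complex.
From mathcomp Require Import cyclic ring.
From mathcomp Require Import all_classical all_reals all_analysis.

Set Implicit Arguments.
Unset Strict Implicit.
Unset Printing Implicit Defensive.

Import Order.TTheory GRing.Theory Num.Theory.
Import numFieldNormedType.Exports.

Local Open Scope classical_set_scope.
Local Open Scope ring_scope.

(** * Two by two matrices and the group [SL2Z] *)

Lemma det_mx22 (R : comPzRingType) (A : 'M[R]_2) :
  \det A = A 0 0 * A 1 1 - A 0 1 * A 1 0.
Proof.
rewrite (expand_det_row A 0) !big_ord_recl big_ord0 addr0 /cofactor
  !det_mx11 !mxE /=.
have -> : lift 0 0 = 1 :> 'I_2 by apply/val_inj.
have -> : lift 1 0 = 0 :> 'I_2 by apply/val_inj.
by rewrite /= !expr0 !expr1 mul1r mulN1r mulrN.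
Qed.

Lemma mulmx22E (R : pzSemiRingType) (A B : 'M[R]_2) i j :
  (A *m B) i j = A i 0 * B 0 j + A i 1 * B 1 j.
Proof.
rewrite mxE !big_ord_recl big_ord0 addr0.
by have -> : lift 0 0 = 1 :> 'I_2 by apply/val_inj.
Qed.

(** A Bezout relation [u * d + v * c = 1] supplies the top row [(u, - v)]. *)
Lemma SL2Z_with_bottom_row (c d : int) :
  coprimez d c -> exists g : 'M[int]_2, [/\ \det g = 1, g 1 0 = c & g 1 1 = d].
Proof.
case/coprimezP=> -[u v] /= uv1.
exists (\matrix_(i, j) if i == 0 then if j == 0 then u else - v
                       else if j == 0 then c else d).
by rewrite det_mx22 !mxE /= mulNr opprK.
Qed.

Lemma coprimez_SL2Z (g : 'M[int]_2) : \det g = 1 -> coprimez (g 1 1) (g 1 0).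
Proof.
rewrite det_mx22 => det1; apply/coprimezP; exists (g 0 0, - g 0 1) => /=.
by rewrite -det1 mulNr.
Qed.

(** * Left cosets of [Gamma1 n] *)

Section GammaHIndex.
Variables (n : nat) (n_gt0 : (0 < n)%N).

Lemma Gamma1P (g : 'M[int]_2) :
  Gamma1 n g <-> [/\ \det g = 1, (n %| g 1%R 0%R)%Z & (n %| (g 1 1 - 1)%R)%Z].
Proof.
split=> [[det1 c0 [x]]|[det1 c0 d1]].
  rewrite inE => /eqP x1 gx; split=> //.
  by rewrite -eqz_mod_dvd gx !modz_nat x1.
(* The residue is [1 %% n] rather than [1], since it must be [0] at level 1. *)
split=> //; exists (Ordinal (ltn_pmod 1 n_gt0)).
  by rewrite inE /= modn_mod.
by move: d1; rewrite -eqz_mod_dvd /= => /eqP ->; rewrite !modz_nat modn_mod.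
Qed.

Definition GammaH_fiber (x : 'I_n) : set 'M[int]_2 :=
  [set g : 'M[int]_2 | [/\ \det g = 1, (n %| g 1%R 0%R)%Z
             & (g 1%R 1%R = x %[mod n])%Z]].

(** When [n] divides the lower left entry of [g], the lower right entry of [g *m h] is congruent to
    the product of the lower right entries. Conversely, the lower right entry of [g] is prime to [n]
    and can be cancelled. *)
Lemma left_coset_fiber (x : 'I_n) g :
  GammaH_fiber x g -> [set g *m h | h in Gamma1 n] = GammaH_fiber x.
Proof.
case=> det1 c0 dx; apply/seteqP; split=> [h [k /Gamma1P [kdet1 kc0 kd1] <-]|h].
  split.
  - by rewrite det_mulmx det1 kdet1 mulr1.
  - by rewrite mulmx22E rpredD ?(dvdz_mulr _ c0) ?(dvdz_mull _ kc0).
  - rewrite -dx; apply/eqP; rewrite eqz_mod_dvd mulmx22E.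
    have -> : g 1 0 * k 0 1 + g 1 1 * k 1 1 - g 1 1 =
      g 1 0 * k 0 1 + g 1 1 * (k 1 1 - 1) by ring.
    by rewrite rpredD ?(dvdz_mulr _ c0) ?(dvdz_mull _ kd1).
case=> hdet1 hc0 hdx.
have g_unit : g \in unitmx by rewrite unitmxE det1 unitr1.
pose k := invmx g *m h; have hE : h = g *m k by rewrite mulKVmx.
have co_nd : coprimez n (g 1 1).
  rewrite coprimez_sym; apply: coprimez_dvdr c0 _; exact: coprimez_SL2Z.
exists k => //; apply/Gamma1P; split.
- by move: hdet1; rewrite hE det_mulmx det1 mul1r.
(* In both remaining goals the term with factor [g 1 0] vanishes modulo [n], and Gauss's lemma then
   removes the factor [g 1 1]. *)
- move: hc0; rewrite hE mulmx22E (rpredDl _ (dvdz_mulr _ c0)).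
  by rewrite Gauss_dvdzr.
- move/eqP: (etrans hdx (esym dx)); rewrite eqz_mod_dvd hE mulmx22E.
  have -> : g 1 0 * k 0 1 + g 1 1 * k 1 1 - g 1 1 =
    g 1 0 * k 0 1 + g 1 1 * (k 1 1 - 1) by ring.
  by rewrite (rpredDl _ (dvdz_mulr _ c0)) Gauss_dvdzr.
Qed.

Lemma GammaH_fiber_ex (x : 'I_n) : coprime x n -> exists g, GammaH_fiber x g.
Proof.
move=> co_xn; have [g [det1 gc gd]] := @SL2Z_with_bottom_row n x co_xn.
by exists g; split; rewrite // ?gc ?gd.
Qed.

(** The cosets are exactly the fibers over [H], so it suffices that distinct residues have distinct
    fibers. *)
Lemma group_index_GammaH (H : {set 'I_n}) :
  H \subset Zn_units n -> group_index (GammaH H) (Gamma1 n) = #|H|.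
Proof.
move=> /fintype.subsetP sHU.
have fiber_ex x : x \in H -> exists g, GammaH_fiber x g.
  by move=> /sHU; rewrite inE; apply: GammaH_fiber_ex.
have cosetsE : left_cosets (GammaH H) (Gamma1 n) = GammaH_fiber @` [set` H].
  apply/seteqP; split=> [_ [g [det1 c0 [x xH dx]] <-]|_ [x /= xH <-]].
    by exists x => //; rewrite (@left_coset_fiber x).
  have [g xg] := fiber_ex x xH; exists g; last exact: left_coset_fiber.
  by case: xg => ? ? ?; split=> //; exists x.
(* Injectivity relies on nonempty fibers: a common element determines the residue, whereas empty
   fibers would coincide. *)
have fiberI : {in fset_set [set` H] &, injective GammaH_fiber}.
  move=> x y; rewrite !in_fset_set; try exact: finite_finset.
  rewrite !inE /= => /fiber_ex [g xg] _ Exy.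
  have: GammaH_fiber y g by rewrite -Exy.
  case: xg => _ _ dx [_ _]; rewrite dx !modz_nat => -[].
  by rewrite !modn_small // => /val_inj.
rewrite /group_index cosetsE fset_set_image; last exact: finite_finset.
rewrite card_in_imfset // cardE.
apply/perm_size/uniq_perm; rewrite ?fset_uniq ?enum_uniq // => x.
by rewrite in_fset_set ?mem_enum ?mem_setE //; exact: finite_finset.
Qed.

End GammaHIndex.

(** * Solutions of [y ^ e = 1] in the cyclic group of units of ['F_l] *)

Lemma expfz_eq1_gcd (F : fieldType) (m : nat) (e : int) (y : F) :
  y ^+ m = 1 -> y != 0 -> (y ^ e == 1) = (y ^+ gcdn m `|e| == 1).
Proof.
move=> ym1 y0.
have -> : (y ^ e == 1) = (y ^+ `|e| == 1).
  by case: e => k //; exact: invr_eq1.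
apply/idP/idP => [/eqP ye1|/eqP yg1]; last first.
  by have /dvdnP[q ->] := dvdn_gcdr m `|e|; rewrite mulnC exprM yg1 expr1n.
have [->|e_gt0] := posnP `|e|; first by rewrite gcdn0 ym1.
(* Bezout in natural numbers: [a * |e| = b * m + gcd]. Raising [y] to both sides leaves only the
   power with exponent the gcd. *)
have [a b Eab _] := egcdnP m e_gt0.
have := congr1 (fun j => y ^+ j) Eab.
rewrite exprD ![(_ * `|e|)%N]mulnC ![(_ * m)%N]mulnC.
by rewrite !exprM ye1 ym1 !expr1n mul1r gcdnC => <-.
Qed.

Lemma Fp_fermat (l : nat) (x : 'F_l) : prime l -> x != 0 -> x ^+ l.-1 = 1.
Proof.
move=> l_prime x0; apply/(mulfI x0).
rewrite mulr1 -exprS prednK ?prime_gt0 //.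
by have := expf_card x; rewrite card_Fp.
Qed.

(** By Fermat the [l.-1] nonzero residues are distinct roots of unity of order dividing [l.-1]; that
    many of them in a field include a primitive one. *)
Lemma Fp_primitive_root (l : nat) : prime l ->
  exists z : 'F_l, l.-1.-primitive_root z.
Proof.
move=> l_prime; pose rs := enum (predC1 (0 : 'F_l)).
have card_rs : size rs = l.-1 by rewrite -cardE cardC1 card_Fp.
have /hasP[z _ zP] : has l.-1.-primitive_root rs.
  apply: has_prim_root; rewrite ?enum_uniq ?card_rs //.
    by rewrite -subn1 subn_gt0 prime_gt1.
  apply/allP => x; rewrite mem_enum unity_rootE inE /= => x0.
  by rewrite Fp_fermat.
by exists z.
Qed.

Lemma card_unity_roots (F : finFieldType) (m : nat) (z : F) :
  m.-primitive_root z -> #|[set y : F | y ^+ m == 1]%SET| = m.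
Proof.
move=> zP; rewrite -[RHS]card_ord.
have zI : injective (fun i : 'I_m => z ^+ i).
  move=> i j /eqP; rewrite (eq_prim_root_expr zP) !modn_small // => /eqP.
  exact: val_inj.
rewrite -(card_imset _ zI); apply: eq_card => y; rewrite inE.
apply/eqP/imsetP => [/(prim_rootP zP)[i ->]|[i _ ->]]; first by exists i.
by rewrite exprAC (prim_expr_order zP) expr1n.
Qed.

(** The exponent may be replaced by its gcd with [l.-1]. As this gcd divides [l.-1], there is a
    primitive root of that order, whose powers are all the solutions. *)
Lemma card_Fp_expz_kernel (l : nat) (e : int) : prime l ->
  #|[set y : 'F_l | (y != 0) && (y ^ e == 1)]%SET| = gcdn l.-1 `|e|.
Proof.
move=> l_prime; have [z zP] := Fp_primitive_root l_prime.
have m_gt0 := prim_order_gt0 zP.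
rewrite -[RHS](card_unity_roots (dvdn_prim_root zP (dvdn_gcdl l.-1 `|e|))).
apply: eq_card => y; rewrite !inE.
have [->|y0] /= := eqVneq y 0.
  (* Zero is no root of unity because the gcd is positive, even for [e = 0]. *)
  by rewrite expr0n eqn0Ngt gcdn_gt0 m_gt0 /= eq_sym oner_eq0.
by rewrite (@expfz_eq1_gcd _ l.-1) // Fp_fermat.
Qed.

(** * Counting residues *)

Lemma card_Zn_units (n : nat) : #|Zn_units n| = totient n.
Proof.
rewrite totient_count_coprime big_mkord -sum1dep_card [RHS]big_mkcond /=.
rewrite big_mkcond; apply: eq_bigr => i _ /=.
by rewrite coprime_sym; case: coprime.
Qed.

(** Reduction modulo [N] and [l] is a bijection onto pairs. The existential expresses that [x]
    modulo [N] lies in [A] without building an element of ['I_N] from [x]. *)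
Lemma card_CRT (N l : nat) (A : {set 'I_N}) (B : {set 'F_l}) :
    (0 < N)%N -> prime l -> coprime N l ->
  #|[set x : 'I_(N * l) | [exists a in A, a == x %[mod N]]
                       && ((x%:R : 'F_l) \in B)]%SET| = (#|A| * #|B|)%N.
Proof.
move=> N_gt0 l_prime co_Nl.
pose phi (x : 'I_(N * l)) : 'I_N * 'F_l := (Ordinal (ltn_pmod x N_gt0), x%:R).
have valF (m : nat) : val (m%:R : 'F_l) = (m %% l)%N by exact: val_Fp_nat.
have phiI : injective phi.
  move=> x y [xyN xyl].
  have {}xyl : (x %% l)%N = (y %% l)%N by rewrite -!valF xyl.
  apply/val_inj/eqP => /=.
  rewrite -[val x](modn_small (ltn_ord x)) -[val y](modn_small (ltn_ord y)).
  by rewrite chinese_remainder // /= xyN xyl !eqxx.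
rewrite -cardsX -(card_imset _ phiI); apply: eq_card => -[a b].
rewrite inE /=; apply/imsetP/andP => [[x]|[aA bB]].
  rewrite inE => /andP[/existsP[a' /andP[a'A /eqP a'x]] xB] [-> ->]; split=> //.
  suff -> : Ordinal (ltn_pmod x N_gt0) = a' by [].
  by apply/val_inj; rewrite /= -a'x modn_small.
have Nl_gt0 : (0 < N * l)%N by rewrite muln_gt0 N_gt0 prime_gt0.
pose r := chinese N l a (val b); pose x := Ordinal (ltn_pmod r Nl_gt0).
have xN : (x %% N = a)%N.
  by rewrite /= modn_dvdm ?dvdn_mulr // chinese_modl // modn_small.
have xl : x%:R = b :> 'F_l.
  apply/val_inj; rewrite valF /= modn_dvdm ?dvdn_mull // chinese_modr //.
  by rewrite modn_small //; have := ltn_ord b; rewrite [X in (_ < X)%N]Fp_cast.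
exists x.
  rewrite inE xl bB andbT; apply/existsP; exists a; rewrite aA.
  by rewrite xN modn_small /=.
by congr pair; first apply/val_inj.
Qed.

(** * The integers in [lam], and the nebentypus *)

Lemma coef_integers_int (R : realType) (a : nat -> R[i]) (m : int) :
  coef_integers a m%:~R.
Proof.
split; last exact: (integral_id intr).
move=> S [S1 SB _] _.
have S0 : 0 \in S by rewrite -(subrr 1); exact: SB.
have SN x : x \in S -> - x \in S by move=> Sx; rewrite -[- x]sub0r; exact: SB.
have Sn (j : nat) : j%:R \in S.
  elim: j => // j IH; rewrite -natr1.
  by have := SB _ _ IH (SN _ S1); rewrite opprK.
by case: m => j; [exact: Sn | rewrite NegzE rmorphN; apply/SN/Sn].
Qed.

(** An integer of [lam] not divisible by [l] would be coprime to [l], and a Bezout relation would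
    put 1 in [lam]. *)
Lemma prime_over_int (R : realType) (a : nat -> R[i]) (lam : set R[i])
    (l : nat) :
    prime l -> prime_over (coef_integers a) lam l ->
  forall m : int, m%:~R \in lam = (l %| m)%Z.
Proof.
move=> l_prime [_ lamD lamM [lam1 _] laml] m.
have lam_mull q : lam (q%:~R * l%:R).
  by apply: lamM => //; apply: coef_integers_int.
apply/idP/idP => [|/dvdzP[q ->]]; last by rewrite rmorphM /= inE.
rewrite inE => mlam; apply: contraT => ldvd; exfalso; apply: lam1.
have /coprimezP[[u v] /= uv1] : coprimez m l.
  by rewrite coprimez_sym coprimezE prime_coprime.
rewrite -[1](rmorph1 intr) -uv1 rmorphD !rmorphM /=; apply: lamD => //.
by apply: lamM => //; apply: coef_integers_int.
Qed.

Lemma Gamma0_nebentypus_trivial (R : realType) (N k : nat) (f : R[i] -> R[i])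
    (a : nat -> R[i]) (eps : int -> R[i]) :
    (0 < N)%N -> normalized_eigenform k (Zn_units N) eps f a ->
  forall x : nat, coprime x N -> eps x = 1.
Proof.
move=> N_gt0 [[_ fG _] [_ fneb] [z Hz fz] _ _] x co_xN.
have [g [det1 gc gd]] := @SL2Z_with_bottom_row N x co_xN.
have Gg : Gamma0 N g.
  split; rewrite ?gc //; exists (Ordinal (ltn_pmod x N_gt0)).
    by rewrite inE /= coprime_modl.
  by rewrite gd !modz_nat /= modn_mod.
have zH := mem_set Hz.
(* [Gamma0 N] unfolds to [GammaH (Zn_units N)], so [Gg] serves both transformation laws; they are
   compared at a point where [f] is nonzero. *)
have := fneb _ Gg z zH; rewrite (fG _ Gg z zH) gd /= => /(canLR (mulfK fz)).
by rewrite divff.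
Qed.

Theorem theorem5p2 (R : realType) (l N k : nat) (F : closedFieldType)
  (l_prime : prime l) (l_ge5 : (5 <= l)%N)
  (N_gt0 : (0 < N)%N) (N_l : coprime N l) (k_gt2 : (2 < k)%N)
  (F_closure : algebraic_over_Fp F l)
  (f : R[i] -> R[i]) (a : nat -> R[i]) (eps : int -> R[i])
  (f_eigen : normalized_eigenform k (Zn_units N) eps f a)
  (lam : set R[i]) (lam_prime : prime_over (coef_integers a) lam l)
  (iota : R[i] -> F)
  (iota_lam : residue_embedding (coef_integers a) lam iota)
  (rho : galrep F) (rho_f : attached_rep l k N eps a iota rho)
  (rho_irr : galrep_irreducible rho)
  (i : nat) (i_le : (i <= l - 1)%N) :
  let H := char_kernel (N * l) l lam eps (k%:Z - 2 - 2 * i%:Z) in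
  (exists (f2 : R[i] -> R[i]) (a2 : nat -> R[i]) (eps2 : int -> R[i])
          (lam2 : set R[i]) (iota2 : R[i] -> F) (rho2 : galrep F),
    [/\ normalized_eigenform 2 H eps2 f2 a2,
        prime_over (coef_integers a2) lam2 l,
        residue_embedding (coef_integers a2) lam2 iota2,
        attached_rep l 2 (N * l) eps2 a2 iota2 rho2
      & galrep_iso rho (fun s => cyclotomic_char F l s ^+ i *: rho2 s)]) ->
  (group_index (GammaH H) (Gamma1 (N * l)))%:R =
    (totient (N * l))%:R * (gcdz (l%:Z - 1) (k%:Z - 2 - 2 * i%:Z))%:~R
      / (l%:R - 1) :> rat.
Proof.
move=> H _; pose e : int := k%:Z - 2 - 2 * i%:Z.
have l_gt0 := prime_gt0 l_prime; have l_gt1 := prime_gt1 l_prime.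
have n_gt0 : (0 < N * l)%N by rewrite muln_gt0 N_gt0.
have sHU : H \subset Zn_units (N * l).
  by apply/fintype.subsetP => x; rewrite !inE => /and3P[].
(* Membership in [H] splits into a condition modulo [N] and one modulo [l], the form that [card_CRT]
   counts. *)
have HE : H = [set x : 'I_(N * l) | [exists a in Zn_units N, a == x %[mod N]]
      && ((x%:R : 'F_l) \in [set y : 'F_l | (y != 0) && (y ^ e == 1)]%SET)]%SET.
  apply/setP => x; rewrite !inE coprimeMr.
  have xl : coprime x l = (x%:R != 0 :> 'F_l).
    by rewrite coprime_sym prime_coprime // (dvdn_pcharf (pchar_Fp l_prime)).
  have -> : [exists b in Zn_units N, b == x %[mod N]] = coprime x N.
    apply/existsP/idP => [[b /andP[]]|co_xN].
      by rewrite inE -coprime_modl => + /eqP Eb; rewrite Eb coprime_modl.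
    exists (Ordinal (ltn_pmod x N_gt0)).
    by rewrite inE /= coprime_modl co_xN modn_mod eqxx.
  rewrite -xl -/e.
  have [co_xN|] := boolP (coprime x N); last by rewrite andbF.
  have [co_xl|] := boolP (coprime x l); last by rewrite /= andbF.
  (* If [x] were 0, its gcd with [l] would be [l], not 1. *)
  have -> : (0 < x)%N.
    by case: posnP co_xl => // ->; rewrite /coprime gcd0n gtn_eqF.
  rewrite /= (Gamma0_nebentypus_trivial N_gt0 f_eigen co_xN) mul1r.
  set y := _ ^ e.
  (* With [eps x = 1] the tested element is an integer, so membership in [lam] becomes divisibility
     by [l], that is [y = 1] in ['F_l]. *)
  have -> : (val y)%:R - 1 = ((val y)%:Z - 1)%:~R :> R[i] by rewrite rmorphB.
  rewrite (prime_over_int l_prime lam_prime) -eqz_mod_dvd !modz_nat eqz_nat.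
  by rewrite -!(val_Fp_nat l_prime) val_eqE natr_Zp.
have -> : group_index (GammaH H) (Gamma1 (N * l)) =
    (totient N * gcdn l.-1 `|e|)%N.
  rewrite group_index_GammaH // HE card_CRT // card_Zn_units.
  by rewrite card_Fp_expz_kernel.
have l1 : l%:R - 1 = l.-1%:R :> rat.
  by rewrite -[in LHS](prednK l_gt0) -natr1 addrK.
have l1' : l%:Z - 1 = l.-1 by rewrite subzn ?subn1.
have l1_neq0 : l.-1%:R != 0 :> rat by rewrite pnatr_eq0 -lt0n -subn1 subn_gt0.
(* The totient of [N * l] contributes the factor [l.-1], which cancels the denominator. *)
rewrite totient_coprime // (totient_prime l_prime) l1 l1' /gcdz !natrM.
by rewrite [RHS]mulrAC mulfK.
Qed.
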